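(* Let $L(x)=\sum_{n\ge0}\ell_n x^n$ and $B(x)=\sum_{n\ge 0}b_nx^n$, where $\ell_n$ and $b_n$ are the numbers of little hybrid paths and of big hybrid paths of length $2n$, respectively. Let $R=\sqrt{x^2-6x+1}$ (the power series with constant term $1$). Then $$L(x)=\frac{R+1-x}{2}\cdot\frac{2(R+x)}{R(R+x+1)}\cdot\frac{2}{R+x+1}$$ and $$B(x)=\left(\frac{R+1-x}{2}-1+x-\frac{R(R+x)}{2}+\frac32-\frac{3x}{2}\right)\frac{2(R+x)}{R(R+x+1)}\cdot\frac{2}{R+x+1}.$$ More explicitly, $$L(x)=\frac{1-5x+\sqrt{x^2-6x+1}}{\left((x-1)^2+(x+1)\sqrt{x^2-6x+1}\right)\sqrt{x^2-6x+1}}$$ and $$B(x)=\frac{7x-2x^2-1+\sqrt{x^2-6x+1}}{2x\sqrt{x^2-6x+1}}-1.$$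
   Context: **Paths.** All lattice paths of length $m$ start at $(0,0)$, end at $(m,0)$, never go below the $x$-axis, and consist of upsteps U $=(1,1)$, downsteps $(1,-1)$, and double horizontal steps HH $=(2,0)$ (each an indivisible ''horizontal step'' contributing $2$ to the length). Each downstep is either ordinary (D) or carries the label ''special'' (d); paths with different labels are different. A Dyck path has no horizontal steps. An even-special (respectively odd-special) Dyck path is a Dyck path in which an arbitrary subset of the downsteps leaving from even (respectively odd) height are labeled special; the height a downstep leaves from is its starting height. **Matching upstep.** The upstep matching a downstep $d$ is the rightmost upstep to the left of $d$ that ends at the height from which $d$ leaves. **The evolution map.** Define a map $E$ on such paths. If a path has no special steps, $E$ leaves it unchanged. Otherwise take the leftmost special step $s$. (Flatten) If $s$ is immediately preceded by an upstep, replace that upstep and $s$ by one horizontal step HH. (Slide) If $s$ is immediately preceded by a downstep $d$ (necessarily ordinary), let $u$ be the upstep matching $d$ and $P$ the (possibly empty) subpath strictly between $u$ and $d$; replace the portion $u\,P\,d\,s$ by HH $P$ D, with D an ordinary downstep. For the paths below these are the only cases that occur. **Hybrid paths.** The set of little (respectively big) hybrid paths is the smallest set of paths that contains all even-special (respectively odd-special) Dyck paths and is closed under this map. *)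

(* Defs.v *)
From HB Require Import structures.
From mathcomp Require Import all_boot all_order all_algebra finmap.
From mathcomp Require Import boolp classical_sets functions cardinality.

Set Implicit Arguments.
Unset Strict Implicit.
Unset Printing Implicit Defensive.

Import Order.TTheory GRing.Theory Num.Theory.

Local Open Scope classical_set_scope.
Local Open Scope ring_scope.

Record fps (R : Type) := Fps { coefs : nat -> R }.

Notation "{ 'fps' R }" := (fps R) (at level 0, format "{ 'fps'  R }").

Section FpsRing.
Variable R : idomainType.
Implicit Types p q r : {fps R}.

HB.instance Definition _ := [isNew for @coefs R].
HB.instance Definition _ := [Choice of {fps R} by <:].

Lemma fpsP p q : coefs p =1 coefs q <-> p = q.
Proof.
split=> [|->//]; case: p q => [f] [g] /= fg.
by congr Fps; apply/funext.
Qed.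

Definition fps_zero : {fps R} := Fps (fun=> 0).
Definition fps_one : {fps R} := Fps (fun n => (n == 0%N)%:R).
Definition fps_opp p := Fps (fun n => - coefs p n).
Definition fps_add p q := Fps (fun n => coefs p n + coefs q n).
Definition fps_mul p q :=
  Fps (fun n => \sum_(i < n.+1) coefs p i * coefs q (n - i)).

Fact fps_addA : associative fps_add.
Proof. by move=> p q r; apply/fpsP => n /=; rewrite addrA. Qed.
Fact fps_addC : commutative fps_add.
Proof. by move=> p q; apply/fpsP => n /=; rewrite addrC. Qed.
Fact fps_add0 : left_id fps_zero fps_add.
Proof. by move=> p; apply/fpsP => n /=; rewrite add0r. Qed.
Fact fps_addN : left_inverse fps_zero fps_opp fps_add.
Proof. by move=> p; apply/fpsP => n /=; rewrite addNr. Qed.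

HB.instance Definition _ :=
  GRing.isZmodule.Build {fps R} fps_addA fps_addC fps_add0 fps_addN.

Let trunc n p : {poly R} := \poly_(i < n.+1) coefs p i.

Let coef_trunc n p k : (k <= n)%N -> (trunc n p)`_k = coefs p k.
Proof. by move=> kn; rewrite coef_poly ltnS kn. Qed.

Let coef_mul_trunc n p q k : (k <= n)%N ->
  coefs (fps_mul p q) k = (trunc n p * trunc n q)`_k.
Proof.
move=> kn; rewrite coefM; apply: eq_bigr => i _.
have ik : (i <= k)%N by rewrite -ltnS.
by rewrite !coef_trunc ?(leq_trans ik) ?(leq_trans (leq_subr _ _)).
Qed.

Let coef_mul_ext (P Q P' Q' : {poly R}) n :
  (forall k, (k <= n)%N -> P`_k = P'`_k) ->
  (forall k, (k <= n)%N -> Q`_k = Q'`_k) -> (P * Q)`_n = (P' * Q')`_n.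
Proof.
move=> hP hQ; rewrite !coefM; apply: eq_bigr => i _.
by rewrite hP ?hQ ?leq_subr// -ltnS.
Qed.

Fact fps_mulC : commutative fps_mul.
Proof.
by move=> p q; apply/fpsP => n; rewrite !(@coef_mul_trunc n)// mulrC.
Qed.
Fact fps_mulA : associative fps_mul.
Proof.
move=> p q r; apply/fpsP => n; rewrite !(@coef_mul_trunc n)//.
transitivity ((trunc n p * (trunc n q * trunc n r))`_n).
  by apply: coef_mul_ext => // k kn; rewrite coef_trunc// (coef_mul_trunc _ _ kn).
rewrite mulrA.
by apply: coef_mul_ext => // k kn; rewrite coef_trunc// (coef_mul_trunc _ _ kn).
Qed.
Fact fps_mul1 : left_id fps_one fps_mul.
Proof.
move=> p; apply/fpsP => n /=; rewrite big_ord_recl /= mul1r subn0.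
by rewrite big1 ?addr0// => i _; rewrite mul0r.
Qed.
Fact fps_mulDl : left_distributive fps_mul fps_add.
Proof.
move=> p q r; apply/fpsP => n /=; rewrite -big_split/=.
by apply: eq_bigr => i _; rewrite mulrDl.
Qed.
Fact fps_one_neq0 : fps_one != 0.
Proof.
by apply/eqP => /fpsP/(_ 0%N)/= /eqP; rewrite oner_eq0.
Qed.

HB.instance Definition _ := GRing.Zmodule_isComNzRing.Build {fps R}
  fps_mulA fps_mulC fps_mul1 fps_mulDl fps_one_neq0.

Definition fps_unit : {pred {fps R}} := fun p => `[< exists q, q * p = 1 >].
Definition fps_inv p :=
  if pselect (exists q, q * p = 1) is left pu then projT1 (cid pu) else p.

Fact fps_mulVx : {in fps_unit, left_inverse 1 fps_inv *%R}.
Proof.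
move=> p /asboolP pu; rewrite /fps_inv; case: pselect => // pu'.
by case: cid.
Qed.
Fact fps_unitP p q : q * p = 1 -> fps_unit p.
Proof. by move=> qp; apply/asboolP; exists q. Qed.
Fact fps_inv_out : {in [predC fps_unit], fps_inv =1 id}.
Proof.
move=> p /asboolP pu; rewrite /fps_inv; case: pselect => // pu'.
Qed.

HB.instance Definition _ := GRing.ComNzRing_hasMulInverse.Build {fps R}
  fps_mulVx fps_unitP fps_inv_out.

Let fps_neq0P p : p != 0 ->
  exists2 i, coefs p i != 0 & forall k, (k < i)%N -> coefs p k = 0.
Proof.
move=> p0; have ex : exists i, coefs p i != 0.
  apply: contrapT => /forallNP h; move/eqP: p0; apply.
  by apply/fpsP => n /=; have /negP := h n; rewrite negbK => /eqP.
exists (ex_minn ex); case: ex_minnP => // i _ mini k.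
by case: (eqVneq (coefs p k) 0) => // /mini; rewrite leqNgt => /negbTE ->.
Qed.

Fact fps_integral : GRing.integral_domain_axiom {fps R}.
Proof.
move=> p q pq0; apply: contraPT pq0; rewrite negb_or.
case/andP=> /fps_neq0P[i pi lti] /fps_neq0P[j qj ltj] /fpsP/(_ (i + j)%N)/=.
have iij : (i < (i + j).+1)%N by rewrite ltnS leq_addr.
rewrite (bigD1 (Ordinal iij))//= addKn big1 ?addr0 => [|k /eqP/eqP ki].
  by apply/eqP; rewrite mulf_neq0.
have [/lti ->|ik] := ltnP k i; first by rewrite mul0r.
rewrite ltj ?mulr0//; have {}ki : (i < k)%N.
  by rewrite ltn_neqAle ik andbT eq_sym; apply: contraNneq ki => ki; apply/eqP/val_inj.
by rewrite ltn_subLR ?ltn_add2r// -ltnS ltn_ord.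
Qed.

HB.instance Definition _ :=
  GRing.ComUnitRing_isIntegral.Build {fps R} fps_integral.

Definition fpsX : {fps R} := Fps (fun n => (n == 1%N)%:R).

End FpsRing.

Arguments fpsX {R}.

(* Quotients of series are meant in the fraction field of {fps R}, since a
   denominator divisible by fpsX is not a unit of {fps R}. *)
Notation "p %:F" := (@FracField.tofrac _ p) : ring_scope.

Section FpsSqrt.
Variables (F : fieldType) (f : {fps F}).

Fixpoint fps_sqrt_prefix n : seq F :=
  if n is m.+1 then
    let s := fps_sqrt_prefix m in
    rcons s (if m is k.+1 then
      (coefs f m - \sum_(i < k) nth 0 s i.+1 * nth 0 s (k - i)) / 2 else 1)
  else [::].

Definition fps_sqrt : {fps F} := Fps (fun n => nth 0 (fps_sqrt_prefix n.+1) n).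

Let size_prefix n : size (fps_sqrt_prefix n) = n.
Proof. by elim: n => //= n IHn; rewrite size_rcons IHn. Qed.

Let nth_prefix n k : (k < n)%N ->
  nth 0 (fps_sqrt_prefix n) k = coefs fps_sqrt k.
Proof.
elim: n => // n IHn; rewrite ltnS leq_eqVlt => /predU1P[->//|kn].
by rewrite -IHn//= nth_rcons size_prefix kn.
Qed.

Let coef_sqrtS n : coefs fps_sqrt n.+1 =
  (coefs f n.+1 - \sum_(i < n) coefs fps_sqrt i.+1 * coefs fps_sqrt (n - i)) / 2.
Proof.
rewrite -(@nth_prefix n.+2)// [fps_sqrt_prefix _]/= -/(fps_sqrt_prefix n.+1).
rewrite nth_rcons size_prefix ltnn eqxx; congr ((_ - _) / _).
by apply: eq_bigr => i _; rewrite !nth_prefix ?ltnS ?leq_subr.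
Qed.

Lemma fps_sqrt_uniq : 2 != 0 :> F -> coefs f 0 = 1 ->
  exists! r : {fps F}, r ^+ 2 = f /\ coefs r 0 = 1.
Proof.
move=> n2 f0; have r0 : coefs fps_sqrt 0 = 1 by [].
have sqrtK : fps_sqrt ^+ 2 = f.
  move: r0 coef_sqrtS; case: fps_sqrt => g /= g0 gS.
  apply/fpsP => -[|n] /=; first by rewrite big_ord1 g0 mulr1 f0.
  rewrite big_ord_recl big_ord_recr /= /bump /= subn0 !add1n subnn g0.
  under eq_bigr do rewrite add1n subSS.
  by rewrite mul1r mulr1 gS addrCA -mulrDl -mulr2n -(mulr_natr (_ - _)) mulfK ?subrKC.
exists fps_sqrt; split=> // s [s2 s0].
have /eqP : (fps_sqrt - s) * (fps_sqrt + s) = 0.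
  by rewrite -subr_sqr sqrtK s2 subrr.
rewrite mulf_eq0 => /orP[|/eqP/fpsP/(_ 0%N)/= /eqP].
  by rewrite subr_eq0 => /eqP.
by rewrite s0 -[1 + 1]/(2%:R) (negbTE n2).
Qed.

End FpsSqrt.

(* Special is the downstep d with label "special"; Flat is the step HH. *)
Inductive step := Up | Down | Special | Flat.

Definition bools_of_step s :=
  match s with
  | Up => (true, true) | Down => (true, false)
  | Special => (false, true) | Flat => (false, false)
  end.
Definition step_of_bools b :=
  match b with
  | (true, true) => Up | (true, false) => Down
  | (false, true) => Special | (false, false) => Flat
  end.
Fact bools_of_stepK : cancel bools_of_step step_of_bools.
Proof. by case. Qed.
HB.instance Definition _ := Finite.copy step (can_type bools_of_stepK).

Implicit Types p : seq step.

Definition path_length p : nat := size p + count_mem Flat p.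

(* the height reached after the first k steps, negative below the x-axis *)
Definition height p k : int :=
  (count_mem Up (take k p))%:Z
    - (count_mem Down (take k p) + count_mem Special (take k p))%:Z.

Definition lattice_path p : Prop :=
  (forall k, 0 <= height p k) /\ height p (size p) = 0.

(* Steps are indexed from 0, so that step k starts at height p k and ends at
   height p k.+1; out of range indices are ruled out by the default Up. *)
Definition special_dyck_path (parity : bool) p : Prop :=
  [/\ lattice_path p, Flat \notin p
    & forall k, nth Up p k = Special -> odd (absz (height p k)) = parity].

Definition matching_up p j : option nat :=
  ohead (rev [seq k <- iota 0 j | (nth Flat p k == Up)
                                  && (height p k.+1 == height p j)]).

(* Where neither Flatten nor Slide applies, p is returned unchanged; this never
   happens to a hybrid path having a special step. *)
Definition evolve p : seq step :=
  if Special \notin p then p else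
  let i := index Special p in
  match nth Flat p i.-1 with
  | Up => take i.-1 p ++ Flat :: drop i.+1 p
  | Down =>
      if matching_up p i.-1 is Some k then
        take k p ++ Flat :: drop k.+1 (take i.-1 p) ++ Down :: drop i.+1 p
      else p
  | _ => p
  end.

Definition hybrid (parity : bool) : set (seq step) :=
  smallest (fun A => evolve @` A `<=` A) (special_dyck_path parity).

Definition little_hybrid := hybrid false.
Definition big_hybrid := hybrid true.

Lemma finite_path_length (A : set (seq step)) n :
  finite_set (A `&` [set p | path_length p = n]).
Proof.
apply: (@sub_finite_set _ _ ((fun t : n.-bseq step => val t) @` setT)).
  move=> p [_ /= pn]; have szp : (size p <= n)%N by rewrite -pn leq_addr.
  by exists (Bseq szp).
exact/finite_image/finite_finset.
Qed.

Definition hybrid_series (A : set (seq step)) : {fps rat} :=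
  Fps (fun n =>
    #|` fset_set (A `&` [set p | path_length p = n.*2]) |%fset%:R).

(* Main.v *)
Require Import Defs.
From mathcomp Require Import all_boot all_order all_algebra.
From mathcomp Require Import finmap zify ring.
From mathcomp Require Import boolp classical_sets cardinality.
Import Order.TTheory GRing.Theory Num.Theory.
Local Open Scope ring_scope.

(** A hybrid path is an evolved prefix followed by an untouched suffix of a
    special Dyck path. An evolved prefix ending at height h splits at its last
    visits as F_0 U F_1 U ... U F_h, and the evolution of a special step sends
    F_(h-1) U F_h with F_h empty to F_(h-1) HH, and with F_h = F U P D to
    F_(h-1) U F HH P D. As the blocks at heights where special steps may start
    never have a flat step on their base, that flat step is the first one on
    the base of the new arch, so the evolution of prefixes is injective. Cutting
    a hybrid path at its leftmost special step therefore identifies hybrid paths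
    of length 2n with the special Dyck paths of length 2n in which at most one
    special step is marked. Let u and v be the series of the special Dyck paths
    based at even and at odd height: u = 1 + a x u v and v = 1 + b x u v with
    {a, b} = {1, 2}. Marking a special step is differentiation with respect to
    its weight, so both series are rational in u, v, x and r. *)

(** * Stacks of blocks encoding evolved prefixes *)

(* Paths above their base, read from the right: [HH t] and [Arch u t] are the
   path of [t] followed by a flat step, respectively by [Up], [u], [Down]. *)
Inductive forest := Leaf | HH of forest | Arch of forest & forest.

Fixpoint fword (t : forest) : seq step :=
  match t with
  | Leaf => [::]
  | HH t' => rcons (fword t') Flat
  | Arch u t' => fword t' ++ Up :: rcons (fword u) Down
  end.

Fixpoint fcat (u t : forest) : forest :=
  match u with
  | Leaf => t
  | HH u' => HH (fcat u' t)
  | Arch v u' => Arch v (fcat u' t)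
  end.

Fixpoint flat_free (t : forest) : bool :=
  match t with Leaf => true | HH _ => false | Arch _ t' => flat_free t' end.

(** A special step is evolved as soon as it is read: an empty top block is the Flatten case, one
    ending in an arch the Slide case. The default case never arises along a special Dyck path. *)
Definition push (st : seq forest) (s : step) : seq forest :=
  match s, st with
  | Up, _ => Leaf :: st
  | Down, u :: t :: st' => Arch u t :: st'
  | Flat, t :: st' => HH t :: st'
  | Special, Leaf :: t :: st' => HH t :: st'
  | Special, Arch v u :: t :: st' => Arch (fcat v (HH u)) t :: st'
  | _, _ => st
  end.

(* A stack lists the blocks between last visits, the top block first. *)
Fixpoint word (st : seq forest) : seq step :=
  match st with
  | [::] => [::]
  | [:: t] => fword t
  | t :: st' => word st' ++ Up :: fword t
  end.

(** [size st'] is the height of the base of [t]. *)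
Fixpoint wf_stack (par : bool) (st : seq forest) : bool :=
  if st is t :: st' then ((odd (size st') == par) ==> flat_free t) && wf_stack par st'
  else true.

Definition run := foldl push [:: Leaf].

Lemma fword_fcat u t : fword (fcat u t) = fword t ++ fword u.
Proof.
elim: u => [|u IHu|v _ u IHu] /=; first by rewrite cats0.
  by rewrite IHu rcons_cat.
by rewrite IHu catA.
Qed.

Lemma word_Up st : (0 < size st)%N -> word (Leaf :: st) = rcons (word st) Up.
Proof. by case: st => // t st _; rewrite /= cats1. Qed.

Lemma word_Down u t st : word (Arch u t :: st) = rcons (word [:: u, t & st]) Down.
Proof. by case: st => [|w st] /=; rewrite !rcons_cat/= -?catA ?rcons_cat. Qed.

Lemma word_cons t st : word (t :: st) = word (Leaf :: st) ++ fword t.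
Proof. by case: st => //= w st; rewrite -catA. Qed.

Lemma word_HH t st : word (HH t :: st) = rcons (word (t :: st)) Flat.
Proof. by rewrite word_cons [in RHS]word_cons rcons_cat. Qed.

Lemma fword_nospecial t : Special \notin fword t.
Proof.
elim: t => //= [t|u IHu t IHt]; first by rewrite mem_rcons inE.
by rewrite mem_cat !inE mem_rcons inE !negb_or IHu IHt.
Qed.

Lemma word_nospecial st : Special \notin word st.
Proof.
elim: st => // t [|w st] IHst; first exact: fword_nospecial.
by rewrite word_cons word_Up// mem_cat mem_rcons inE !negb_or IHst fword_nospecial.
Qed.

Lemma fcat_Leaf t : fcat t Leaf = t.
Proof. by elim: t => //= [t ->|u _ t ->]. Qed.

Lemma foldl_fword t w st : foldl push (w :: st) (fword t) = fcat t w :: st.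
Proof.
elim: t w st => //= [t IHt|u IHu t IHt] w st.
  by rewrite -cats1 foldl_cat IHt.
by rewrite foldl_cat IHt /= -cats1 foldl_cat IHu /= fcat_Leaf.
Qed.

(** Decomposition at last visits is unique, and [word st] has no special step to evolve. *)
Lemma run_word st : (0 < size st)%N -> run (word st) = st.
Proof.
elim: st => // t [|w st] IHst _; first by rewrite /run foldl_fword fcat_Leaf.
by rewrite word_cons word_Up// /run -cats1 !foldl_cat -/(run (word _)) IHst//=
  foldl_fword fcat_Leaf.
Qed.

(** * Heights, and one evolution step read on stacks *)

Definition ht (w : seq step) : int :=
  (count_mem Up w)%:Z - (count_mem Down w + count_mem Special w)%:Z.

Lemma heightE p k : height p k = ht (take k p).
Proof. by []. Qed.

Lemma ht_cat u w : ht (u ++ w) = ht u + ht w.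
Proof. by rewrite /ht !count_cat; lia. Qed.

Lemma ht_cons s w : ht (s :: w) = ht [:: s] + ht w.
Proof. by rewrite -cat1s ht_cat. Qed.

Lemma ht_rcons s w : ht (rcons w s) = ht w + ht [:: s].
Proof. by rewrite -cats1 ht_cat. Qed.

Lemma ht_fword t : ht (fword t) = 0.
Proof.
elim: t => //= [t IHt|u IHu t IHt]; first by rewrite ht_rcons IHt.
by rewrite ht_cat ht_cons ht_rcons IHt IHu.
Qed.

Lemma ht_fword_prefix t k : 0 <= ht (take k (fword t)).
Proof.
elim: t k => //= [t IHt|u IHu t IHt] k.
  rewrite -cats1 take_cat; case: ifP => _ //; rewrite ht_cat ht_fword.
  by case: (k - _)%N => [|[]].
rewrite take_cat; case: ifP => _ //; rewrite ht_cat ht_fword add0r.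
case: (k - _)%N => // {}k; rewrite /= ht_cons -cats1 take_cat; case: ifP => _.
  by rewrite addr_ge0.
by rewrite ht_cat ht_fword; case: (k - _)%N => [|[]].
Qed.

Lemma ht_fword_Up t k : nth Flat (fword t) k = Up -> 0 < ht (take k.+1 (fword t)).
Proof.
move=> tk; have kt : (k < size (fword t))%N.
  by rewrite ltnNge; apply/negP => /(nth_default Flat); rewrite tk.
by rewrite (take_nth Flat kt) tk ht_rcons ltr_wpDl// ht_fword_prefix.
Qed.

(** By [ht_fword_Up] no upstep inside the block ends at its base height, so the rightmost candidate
    is the upstep opening the arch. *)
Lemma matching_up_arch X t Q :
  matching_up (X ++ Up :: fword t ++ Q) (size X + (size (fword t)).+1) = Some (size X).
Proof.
rewrite /matching_up; set p := X ++ _; set P := fword t; set x := size X;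
  set j := (x + _)%N.
have takej : height p j = ht X + 1.
  rewrite heightE /p /j take_cat ltnNge leq_addr/= -/x addKn /= take_size_cat//.
  by rewrite ht_cat ht_cons ht_fword addr0.
rewrite /j iotaD filter_cat rev_cat add0n [iota x _]/= -/j [filter _ (_ :: _)]/=.
have -> : (nth Flat p x == Up) && (height p x.+1 == height p j).
  rewrite /p nth_cat ltnn subnn/= takej heightE take_cat -/x ltnNge leqnSn/=.
  by rewrite subSnn /= take0 ht_cat.
rewrite (@eq_in_filter _ _ pred0) ?filter_pred0 ?rev_cons//= => k.
rewrite mem_iota => /andP[xk kj]; apply/negP => /andP[/eqP pk /eqP].
rewrite takej heightE /p take_cat ltnNge -/x leqW 1?ltnW//=.
have -> : (k.+1 - x = (k - x.+1).+2)%N by lia.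
move: pk; rewrite /p nth_cat ltnNge -/x (ltnW xk)/=.
have -> : (k - x = (k - x.+1).+1)%N by lia.
rewrite /= !nth_cat; have kP : (k - x.+1 < size P)%N by move: kj; rewrite /P; lia.
rewrite kP => /ht_fword_Up; rewrite takel_cat// ht_cat ht_cons -/P.
have -> : ht [:: Up] = 1 by [].
by move: (ht _) (ht X); lia.
Qed.

(** As [word st] has no special step, the displayed one is the leftmost. A top block ending in a
    flat step fits neither Flatten nor Slide. *)
Lemma evolve_special st Q : (1 < size st)%N ->
  (if st is HH _ :: _ then false else true) ->
  evolve (word st ++ Special :: Q) = word (push st Special) ++ Q.
Proof.
case: st => // t [//|w st] _ tHH.
have idx :
  index Special (word [:: t, w & st] ++ Special :: Q) = size (word [:: t, w & st]).
  by rewrite index_cat (negbTE (word_nospecial _)) /= addn0.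
rewrite /evolve mem_cat mem_head orbT [~~ true]/= idx.
case: t tHH {idx} => [_|//|v u _].
  rewrite (@word_Up (w :: st))// size_rcons nth_cat size_rcons ltnSn nth_rcons ltnn
    eqxx.
  rewrite cat_rcons take_size_cat// drop_cat ltnNge leqW// subSn// subSnn.
  by rewrite -cat_rcons -word_HH /= drop0.
(* Slide: [X] is the path up to the matching upstep and [P] the inside of the last arch. *)
set X := word [:: u, w & st]; set P := fword v.
have -> : word (Arch v u :: w :: st) = X ++ Up :: rcons P Down.
  by rewrite /X word_cons [in RHS]word_cons -catA.
set i := size _; set p := _ ++ _ :: Q.
have pE : p = (X ++ Up :: P) ++ Down :: Special :: Q.
  by rewrite /p -!catA /= cat_rcons.
have iE : i = (size (X ++ Up :: P)).+1 by rewrite /i !size_cat /= size_rcons addnS.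
rewrite {1}pE iE [_.-1]/= nth_cat ltnn subnn [nth _ _ _]/=.
have -> : matching_up p (size (X ++ Up :: P)) = Some (size X).
  by rewrite pE size_cat -catA matching_up_arch.
rewrite {1}pE -catA take_size_cat// pE take_size_cat//.
have -> : drop (size X).+1 (X ++ Up :: P) = P.
  by rewrite -cat_rcons drop_size_cat ?size_rcons.
rewrite -[_ ++ Down :: _ :: _]cat_rcons -[_ ++ Special :: _]cat_rcons drop_size_cat
  ?size_rcons//.
rewrite [push _ _]/= word_Down word_cons fword_fcat.
by rewrite catA [fword (HH u)]/= -rcons_cat -word_cons cat_rcons -/X cat_rcons -catA.
Qed.

(** * Marked special Dyck suffixes, counted by their first step *)

(* Special Dyck suffixes from height [h]; if [m], at most one special step may be
   marked, and it is then written [Flat]. *)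
Fixpoint marked_dyck (m par : bool) (h : nat) (v : seq step) : bool :=
  match v, h with
  | [::], _ => h == 0
  | Up :: v', _ => marked_dyck m par h.+1 v'
  | Down :: v', h'.+1 => marked_dyck m par h' v'
  | Special :: v', h'.+1 => (odd h == par) && marked_dyck m par h' v'
  | Flat :: v', h'.+1 => [&& m, odd h == par & marked_dyck false par h' v']
  | _ :: _, 0 => false
  end.

Fixpoint words (n : nat) : seq (seq step) :=
  if n is n'.+1 then [seq s :: v | s <- [:: Up; Down; Special; Flat], v <- words n']
  else [:: [::]].

Lemma mem_words n v : (v \in words n) = (size v == n).
Proof.
elim: n v => [|n IHn] v; first by rewrite inE; case: v.
apply/allpairsP/idP => [[[s u] /= [_]]|]; first by rewrite IHn => /eqP <- ->.
case: v => // s v; rewrite eqSS -IHn => vn.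
by exists (s, v); split=> //=; case: s.
Qed.

Lemma uniq_words n : uniq (words n).
Proof.
elim: n => // n IHn; apply: allpairs_uniq => //.
by move=> [s u] [s' u'] _ _ /= [-> ->].
Qed.

Definition count_marked par m n h := count (marked_dyck m par h) (words n).

Lemma count_markedS0 par m n : count_marked par m n.+1 0 = count_marked par m n 1.
Proof.
rewrite /count_marked /= /allpairs_dep /= cats0 !count_cat !count_map.
have E s : s != Up -> count (preim (cons s) (marked_dyck m par 0)) (words n) = 0%N.
  by move=> sU; rewrite (eq_count (a2 := pred0)) ?count_pred0// => v; case: s sU.
by rewrite (E Down)// !addn0.
Qed.

Lemma count_markedSS par m n h : count_marked par m n.+1 h.+1 =
  (count_marked par m n h.+2 + count_marked par m n h
   + (if odd h.+1 == par
      then count_marked par m n h + (if m then count_marked par false n h else 0)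
      else 0))%N.
Proof.
rewrite /count_marked /= /allpairs_dep /= cats0 !count_cat !count_map.
rewrite -addnA; congr (_ + (_ + _))%N.
have [hp|hp] := boolP (odd h.+1 == par); last first.
  rewrite !(eq_count (a1 := preim _ _) (a2 := pred0)) ?count_pred0// => v /=;
    by rewrite (negbTE hp) ?andbF.
rewrite (eq_count (a1 := preim (cons Special) _) (a2 := marked_dyck m par h)) =>
  [|v]; last first.
  by rewrite /= hp.
congr (_ + _)%N; case: m; first by apply: eq_count => v /=; rewrite hp.
by rewrite (eq_count (a2 := pred0)) ?count_pred0.
Qed.

Lemma marked_dyck_size m par h v : marked_dyck m par h v -> (h <= size v)%N.
Proof.
elim: v m h => [|[] v IHv] m [|h] //=.
- by move/IHv/ltnW/ltnW.
- by move/IHv.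
- by case/andP=> _ /IHv.
- by case/and3P=> _ _ /IHv.
Qed.

Lemma count_marked_eq0 par m n h : (n < h)%N -> count_marked par m n h = 0%N.
Proof.
move=> nh; apply/eqP; rewrite -leqn0 leqNgt -has_count; apply/hasPn => v.
by rewrite mem_words => /eqP vn; apply: contraL nh => /marked_dyck_size;
  rewrite vn -leqNgt.
Qed.

(** * From counts to power series *)

Lemma coef_fpsXM0 (R : idomainType) (p : {fps R}) : coefs (fpsX * p) 0 = 0.
Proof. by rewrite /= big_ord1 mul0r. Qed.

Lemma coef_fpsXMS (R : idomainType) (p : {fps R}) n : coefs (fpsX * p) n.+1 = coefs p n.
Proof.
rewrite /= !big_ord_recl /= mul0r add0r mul1r subSS subn0 big1 ?addr0// => i _.
by rewrite mul0r.
Qed.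

(** A suffix from height [h] with [j] upsteps has [j.*2 + h] steps, so [fpsX] marks upsteps. The
    hypotheses on [g] express the decomposition by first step. *)
Lemma coef_count_marked par (g : bool -> nat -> {fps rat}) :
  (forall m, g m 0%N = 1 + fpsX * g m 1%N) ->
  (forall m h, g m h.+1 = fpsX * g m h.+2 + g m h +
     if odd h.+1 == par then g m h + (if m then g false h else 0) else 0) ->
  forall m j h, coefs (g m h) j = (count_marked par m (j.*2 + h) h)%:R.
Proof.
move=> g0 gS m j h; move: {2}(j.*2 + h)%N (erefl (j.*2 + h)%N) => n.
elim: n m j h => [|n IHn] m j h.
  case: j => //; case: h => // _; rewrite g0.
  transitivity (1 + coefs (fpsX * g m 1%N) 0)%R => //.
  by rewrite coef_fpsXM0 addr0.
case: h => [|h].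
  case: j => // j; rewrite addn0 doubleS => -[jn].
  rewrite count_markedS0 g0; transitivity (0 + coefs (fpsX * g m 1%N) j.+1)%R => //.
  by rewrite add0r coef_fpsXMS (IHn m j 1%N) ?addn1 // jn.
rewrite addnS => -[jh].
have E m' : coefs (g m' h) j = (count_marked par m' (j.*2 + h) h)%:R by apply: IHn.
rewrite count_markedSS gS.
transitivity (coefs (fpsX * g m h.+2) j + coefs (g m h) j +
   (if odd h.+1 == par then coefs (g m h) j + (if m then coefs (g false h) j else 0)
     else 0)).
  by case: ifP => _; first case: ifP => _.
rewrite (E m) (E false) !natrD; congr (_ + _ + _); last first.
  by case: ifP => _ //; rewrite natrD; case: ifP.
(* Without upsteps the first term vanishes: [h] steps cannot descend from height [h.+2]. *)
case: j jh {E} => [|j] jh; first by rewrite coef_fpsXM0 count_marked_eq0 // doubleE.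
have jE : (j.*2 + h.+2 = j.+1.*2 + h)%N by rewrite doubleS !addSn !addnS.
by rewrite coef_fpsXMS (IHn m j h.+2) jE.
Qed.

(** * Agreement of [marked_dyck] with special Dyck paths *)

Definition special_dyck_from par (h : nat) v : Prop :=
  [/\ forall k, 0 <= h%:Z + height v k, h%:Z + height v (size v) = 0,
      Flat \notin v
    & forall k, nth Up v k = Special -> odd `|h%:Z + height v k| = par].

Lemma special_dyck_from_cons par h h' s v : ht [:: s] = h'%:Z - h%:Z -> s != Flat ->
  (s = Special -> odd h = par) ->
  special_dyck_from par h (s :: v) <-> special_dyck_from par h' v.
Proof.
move=> hs sF sP.
have hS k : h%:Z + height (s :: v) k.+1 = h'%:Z + height v k.
  by rewrite !heightE /= ht_cons hs; ring.
split=> [[h0 hn vF vS]|[h0 hn vF vS]]; split.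
- by move=> k; rewrite -hS.
- by rewrite -hS.
- by move: vF; rewrite inE negb_or => /andP[].
- by move=> k kS; rewrite -hS; apply: vS.
- by case=> [|k]; rewrite ?hS// heightE take0 addr0.
- by rewrite hS.
- by rewrite inE negb_or eq_sym sF.
- case=> [/sP <-|k /vS <-]; last by rewrite hS.
  by rewrite heightE take0 addr0.
Qed.

Lemma marked_dyck_from par h v :
  marked_dyck false par h v <-> special_dyck_from par h v.
Proof.
elim: v h => [|s v IHv] h.
  split=> [/eqP ->|[_ + _ _]]; last by rewrite heightE addr0 => -[->].
  by split=> // k; rewrite ?heightE ?nth_nil.
have neg : special_dyck_from par 0 (s :: v) -> 0 <= ht [:: s].
  by case=> /(_ 1%N) + _ _ _; rewrite heightE /= take0 add0r.
case: s neg => /= neg.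
- by rewrite IHv; symmetry; apply: special_dyck_from_cons => //;
  rewrite -addn1 PoszD addrC addKr.
- case: h => [|h]; first by split=> // /neg.
  by rewrite IHv; symmetry; apply: special_dyck_from_cons => //;
    rewrite -addn1 PoszD opprD addNKr.
- case: h => [|h]; first by split=> // /neg.
  have [hp|hp] := eqVneq (odd h.+1) par; last first.
    by split=> // -[_ _ _ /(_ 0%N erefl)]; rewrite heightE take0 addr0 => /eqP;
      rewrite (negbTE hp).
  by rewrite IHv; symmetry; apply: special_dyck_from_cons => //;
    rewrite -addn1 PoszD opprD addNKr.
- by split=> [|[]]; case: h.
Qed.

Lemma special_dyckP par v : special_dyck_path par v <-> marked_dyck false par 0 v.
Proof.
have E k : 0%:Z + height v k = height v k by rewrite add0r.
rewrite marked_dyck_from; split=> [[[h0 hn] vF vS]|[h0 hn vF vS]].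
  by split=> // [k||k /vS]; rewrite E.
split=> // [|k]; last by rewrite -E; apply: vS.
by split=> [k|]; rewrite -E.
Qed.

(** * Injectivity of the evolution of prefixes *)

Definition enabled par st s :=
  wf_stack par st &&
  match s with
  | Up => 0 < size st
  | Down => 1 < size st
  | Special => (1 < size st) && (odd (size st).-1 == par)
  | Flat => false
  end%N.

(** At a special step, well-formedness rules out a top block ending in a flat step, on which [push]
    would do nothing and lose track of the height. *)
Lemma marked_dyck_enabled par st s Q : wf_stack par st -> (0 < size st)%N ->
  marked_dyck false par (size st).-1 (s :: Q) ->
  enabled par st s /\ marked_dyck false par (size (push st s)).-1 Q.
Proof.
case: st => // u st; rewrite /enabled => wf _; rewrite wf; case: s => //=.
- by case: st wf => //= t st; case: u.
- case: st wf => //= t st + /andP[/eqP sp].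
  by rewrite sp eqxx; case: u => [|u|v u].
by case: st wf.
Qed.

(** After a special step the top block lies one level lower, at a height of the other parity, where
    flat steps on the base are allowed. *)
Lemma enabled_wf par st s : enabled par st s ->
  wf_stack par (push st s) /\ (0 < size (push st s))%N.
Proof.
case: st => [|u st]; first by case: s.
rewrite /enabled => /andP[/= /andP[]]; case: s => //= [-> -> _|uF|uF].
- by rewrite implybT.
- by case: st uF => //= t st _ /andP[-> ->].
- case: st uF => //= t st + /andP[tF wf] /eqP sp; rewrite sp eqxx /= => uF.
  have np : (odd (size st) == par) = false by rewrite -sp; case: odd.
  by case: u uF => [|u|v u] //= _; rewrite np wf.
Qed.

Lemma flat_free_fcat_HH v u : flat_free (fcat v (HH u)) = false.
Proof. by elim: v. Qed.

(** The displayed flat step is the first one on the base, so it shows where to cut. *)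
Lemma fcat_HH_inj v1 u1 v2 u2 : flat_free u1 -> flat_free u2 ->
  fcat v1 (HH u1) = fcat v2 (HH u2) -> v1 = v2 /\ u1 = u2.
Proof.
move=> F1 F2; elim: v1 v2 => [|v1 IHv|x _ v1 IHv] [|v2|y v2] //=.
- by case.
- by case=> E; rewrite E flat_free_fcat_HH in F1.
- by case=> E; rewrite -E flat_free_fcat_HH in F2.
- by case=> /IHv[-> ->].
- by case=> -> /IHv[-> ->].
Qed.

(** Equal results force equal starting heights. The arch closed by [Down] then has no flat step on
    its inner base, whereas Slide puts one there and Flatten makes no arch. *)
Lemma push_Down_Special par st1 st2 : enabled par st1 Down -> enabled par st2 Special ->
  push st1 Down <> push st2 Special.
Proof.
case: st1 => [|u1 [|t1 st1]]; rewrite /enabled /= ?andbF// => /andP[/andP[ff1 _] _].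
case: st2 => [|u2 [|t2 st2]]; rewrite /enabled /= ?andbF// => /andP[/andP[+ _] /eqP sp].
rewrite sp eqxx /=; case: u2 => //= v u2 _ [uE _ stE].
by move: ff1; rewrite stE sp eqxx uE flat_free_fcat_HH.
Qed.

Lemma push_inj par st1 s1 st2 s2 : enabled par st1 s1 -> enabled par st2 s2 ->
  push st1 s1 = push st2 s2 -> st1 = st2 /\ s1 = s2.
Proof.
move=> en1 en2; have := @push_Down_Special par st1 st2;
  have := @push_Down_Special par st2 st1.
case: s1 en1 => en1; case: s2 en2 => en2 DS12 DS21; try by case/andP: en1; try
  by case/andP: en2.
- by case=> ->.
- by case: st2 en2 {DS12 DS21} => [|u3 [|t3 st3]]; rewrite /enabled /= ?andbF.
- by case: st2 en2 {DS12 DS21} => [|[|u3|v3 u3] [|t3 st3]];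
  rewrite /enabled /= ?andbF ?andbT// => /andP[/andP[+ _] /eqP ->]; rewrite eqxx.
- by case: st1 en1 {DS12 DS21} => [|u3 [|t3 st3]]; rewrite /enabled /= ?andbF.
- case: st1 en1 {DS12 DS21} => [|u1 [|t1 st1]]; rewrite /enabled /= ?andbF// => _.
  case: st2 en2 => [|u2 [|t2 st2]]; rewrite /enabled /= ?andbF// => _.
  by case=> -> -> ->.
- by move=> /(DS21 en1 en2).
- by case: st1 en1 {DS12 DS21} => [|[|u3|v3 u3] [|t3 st3]];
  rewrite /enabled /= ?andbF ?andbT// => /andP[/andP[+ _] /eqP ->]; rewrite eqxx.
- by move=> /esym/(DS12 en2 en1).
(* Two special steps: Flatten leaves a block ending in a flat step, Slide one ending in an arch. *)
case: st1 en1 {DS12 DS21} => [|u1 [|t1 st1]]; rewrite /enabled /= ?andbF// =>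
  /andP[/andP[ff1 _] /eqP sp1].
case: st2 en2 => [|u2 [|t2 st2]]; rewrite /enabled /= ?andbF// =>
  /andP[/andP[ff2 _] /eqP sp2].
rewrite sp1 eqxx /= in ff1; rewrite sp2 eqxx /= in ff2.
case: u1 ff1 => [|u1|v1 u1] //= ff1; case: u2 ff2 => [|u2|v2 u2] //= ff2; case=> //.
  by move=> -> ->.
by move=> /fcat_HH_inj[]// -> -> -> ->.
Qed.

Lemma run_wf par w Q : marked_dyck false par 0 (w ++ Q) ->
  [/\ wf_stack par (run w), (0 < size (run w))%N
    & marked_dyck false par (size (run w)).-1 Q].
Proof.
rewrite /run; elim/last_ind: w Q => [|w s IHw] Q; first by rewrite /= andbT implybT.
rewrite cat_rcons -cats1 foldl_cat =>
  /IHw[wf s0 /(marked_dyck_enabled _ _ _ _ wf s0)[en okQ]].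
by have [? ?] := enabled_wf _ _ _ en; split.
Qed.

Lemma run_rcons w s : run (rcons w s) = push (run w) s.
Proof. by rewrite /run -cats1 foldl_cat. Qed.

Lemma run_rcons_enabled par w s Q : marked_dyck false par 0 (rcons w s ++ Q) ->
  enabled par (run w) s.
Proof.
by rewrite cat_rcons => /run_wf[wf s0 /(marked_dyck_enabled _ _ _ _ wf s0)[]].
Qed.

Lemma push_neq_init par st s : enabled par st s -> push st s <> [:: Leaf].
Proof.
case: st => [|u st]; first by case: s.
rewrite /enabled => /andP[/= /andP[ff _]]; case: s => //=; case: st ff =>
  //= t [|t' st] ff //.
  by move/eqP=> sp; move: ff; rewrite sp eqxx; case: u.
by case: u {ff}.
Qed.

Lemma run_inj par w1 w2 Q1 Q2 : marked_dyck false par 0 (w1 ++ Q1) ->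
  marked_dyck false par 0 (w2 ++ Q2) ->
  run w1 = run w2 -> w1 = w2.
Proof.
elim/last_ind: w1 w2 Q1 Q2 => [|w1 s1 IHw] w2 Q1 Q2; case/lastP: w2 =>
  [|w2 s2] // ok1 ok2.
- by rewrite run_rcons => /esym /(push_neq_init _ _ _ (run_rcons_enabled _ _ _ _ ok2)).
- by rewrite run_rcons => /(push_neq_init _ _ _ (run_rcons_enabled _ _ _ _ ok1)).
rewrite !run_rcons.
move/(push_inj _ _ _ _ _ (run_rcons_enabled _ _ _ _ ok1) (run_rcons_enabled _ _ _ _
  ok2)) => [wE ->].
by move: ok1 ok2; rewrite !cat_rcons => ok1 ok2; rewrite (IHw _ _ _ ok1 ok2 wE).
Qed.

(** * Hybrid paths as evolved prefixes with untouched suffixes *)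

Lemma word_push par st s : enabled par st s -> s <> Special ->
  word (push st s) = rcons (word st) s.
Proof.
case: st => [|u st]; first by case: s.
case: s => //; first by move=> _ _; apply: word_Up.
  by case: st => [|t st] //; rewrite /enabled ?andbF// => _ _; apply: word_Down.
by rewrite /enabled andbF.
Qed.

Lemma word_run_cat par w Q R : marked_dyck false par 0 (w ++ Q ++ R) ->
  Special \notin Q ->
  word (run (w ++ Q)) = word (run w) ++ Q.
Proof.
elim/last_ind: Q R => [|Q s IHQ] R; first by rewrite !cats0.
rewrite -rcons_cat cat_rcons mem_rcons inE negb_or eq_sym => ok /andP[/eqP sS QS].
rewrite -rcons_cat run_rcons (word_push par) ?(IHQ _ ok)// -?rcons_cat//.
by apply: (run_rcons_enabled _ _ _ R); rewrite cat_rcons -catA.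
Qed.

Lemma word_run_Special par w Q : marked_dyck false par 0 (w ++ Special :: Q) ->
  evolve (word (run w) ++ Special :: Q) = word (run (rcons w Special)) ++ Q.
Proof.
rewrite -cat_rcons => /run_rcons_enabled; rewrite run_rcons =>
  /andP[+ /andP[s1 /eqP sp]].
move=> wf; apply: evolve_special => //.
by case: (run w) s1 sp wf => //= -[]//= t st _ ->; rewrite eqxx.
Qed.

Lemma index_split (T : eqType) (x : T) (s : seq T) : x \in s ->
  [/\ s = take (index x s) s ++ x :: drop (index x s).+1 s
    & x \notin take (index x s) s].
Proof.
elim: s => //= y s IHs; rewrite inE eq_sym; case: eqVneq => [->|yx] /=.
  by rewrite drop0.
move=> /IHs[sE xs]; split; first by rewrite -sE.
by rewrite inE negb_or eq_sym yx.
Qed.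

(** The form on the right covers special Dyck paths by an empty [w], and [evolve] only moves the cut
    past the next special step. Conversely, by induction on [w], a last ordinary step merely shifts
    the cut and a last special step is one application of [evolve]. *)
Lemma hybridP par p :
  hybrid par p <->
  exists w Q, marked_dyck false par 0 (w ++ Q) /\ p = word (run w) ++ Q.
Proof.
split=> [|[w [Q [ok ->]]]].
  move: p; apply: smallest_sub => [|q /special_dyckP ok]; last by exists [::], q.
  move=> _ [q + <-].
    case=> w [Q [ok ->]].
    have [SQ|SQ] := boolP (Special \in Q); last first.
      by exists w, Q; rewrite /evolve mem_cat negb_or word_nospecial SQ.
    have [QE Su] := index_split _ _ _ SQ; move: QE Su.
    move: (take _ _) (drop _ _) => u Q' QE Su.
    exists (rcons (w ++ u) Special), Q'.
    have ok' : marked_dyck false par 0 ((w ++ u) ++ Special :: Q') by rewrite -catA -QE.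
    split; first by rewrite cat_rcons.
    rewrite QE catA -(word_run_cat par w u (Special :: Q'))//; last by rewrite -QE.
    exact: word_run_Special ok'.
elim/last_ind: w Q ok => [|w s IHw] Q ok.
  by apply: sub_gen_smallest; apply/special_dyckP.
have [sS|/eqP sS] := eqVneq s Special; last first.
  rewrite run_rcons (word_push par) ?cat_rcons//; first by apply: IHw;
    rewrite -cat_rcons.
  exact: run_rcons_enabled ok.
move: ok; rewrite sS cat_rcons => ok; rewrite -(word_run_Special par)//.
move=> A CA; have [closedA _] := CA; apply: closedA.
by exists (word (run w) ++ Special :: Q) => //; apply: IHw ok A CA.
Qed.

(** * Preservation of the length *)

Lemma path_length_cat u w : path_length (u ++ w) = (path_length u + path_length w)%N.
Proof. by rewrite /path_length size_cat count_cat addnACA. Qed.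

Lemma path_length_rcons w s :
  path_length (rcons w s) = (path_length w + path_length [:: s])%N.
Proof. by rewrite -cats1 path_length_cat. Qed.

(** A flat step has length two, which pays for the upstep and the downstep that Flatten or Slide
    removes. *)
Lemma path_length_push par st s : enabled par st s ->
  path_length (word (push st s)) = (path_length (word st)).+1.
Proof.
have [->|/eqP sS en] := eqVneq s Special; last first.
  rewrite (word_push par)// path_length_rcons.
  by case: s sS en => // [_ _|_ _|_ /andP[]]//; rewrite addn1.
case: st => [|u [|t st]]; rewrite /enabled /= ?andbF// => /andP[/andP[+ _] /eqP sp].
rewrite sp eqxx /=; case: u => [_|//|v u _].
  rewrite -/(word (Leaf :: t :: st)) -/(word (HH t :: st)) word_HH word_Up//.
  by rewrite !path_length_rcons -addnS.
rewrite -/(word (Arch v u :: t :: st)) -/(word (Arch (fcat v (HH u)) t :: st))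
  !word_Down.
rewrite word_cons [in RHS]word_cons (@word_Up (u :: _))// [in RHS]word_cons fword_fcat.
rewrite [fword (HH u)]/= !(path_length_rcons, path_length_cat).
have -> : path_length [:: Flat] = (path_length [:: Up]).+1 by [].
lia.
Qed.

Lemma path_length_run par w Q : marked_dyck false par 0 (w ++ Q) ->
  path_length (word (run w)) = size w.
Proof.
elim/last_ind: w Q => [|w s IHw] Q // ok.
rewrite run_rcons (path_length_push par) ?(run_rcons_enabled _ _ _ _ ok)// size_rcons.
by rewrite (IHw (s :: Q)) -?cat_rcons.
Qed.

Lemma path_length_noflat w : Flat \notin w -> path_length w = size w.
Proof. by move/count_memPn; rewrite /path_length => ->; rewrite addn0. Qed.

(** * The bijection with marked special Dyck paths *)

Lemma marked_dyck_noflat par h v : marked_dyck false par h v -> Flat \notin v.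
Proof. by case/marked_dyck_from. Qed.

Lemma marked_dyck_unmark par h w Q : Flat \notin w ->
  marked_dyck true par h (w ++ Flat :: Q) = marked_dyck false par h (w ++ Special :: Q).
Proof.
elim: w h => //= s w IHw h; rewrite inE.
by case: s => //= wF; case: h => [|h]; rewrite ?IHw.
Qed.

Lemma marked_dyck_true_noflat par h w : Flat \notin w ->
  marked_dyck true par h w = marked_dyck false par h w.
Proof.
elim: w h => //= s w IHw h; rewrite inE.
by case: s => //= wF; case: h => [|h]; rewrite ?IHw.
Qed.

(** The mark becomes the leftmost special step of the image; without a mark the whole path is
    evolved. *)
Definition evolve_marked (v : seq step) : seq step :=
  let i := index Flat v in
  word (run (take i v)) ++ (if Flat \in v then Special :: drop i.+1 v else [::]).

Variant marked_spec par v : seq step -> Prop :=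
| MarkedNone of marked_dyck false par 0 v : marked_spec par v (word (run v) ++ [::])
| MarkedAt w Q of v = w ++ Flat :: Q & marked_dyck false par 0 (w ++ Special :: Q)
    & Flat \notin Q : marked_spec par v (word (run w) ++ Special :: Q).

Lemma markedP par v : marked_dyck true par 0 v -> marked_spec par v (evolve_marked v).
Proof.
rewrite /evolve_marked; have [vF|vF] := boolP (Flat \in v); last first.
  rewrite marked_dyck_true_noflat// memNindex// take_size; exact: MarkedNone.
have [vE wF] := index_split _ _ _ vF;
  rewrite [in marked_dyck _ _ _ v]vE marked_dyck_unmark// => ok.
apply: MarkedAt => //; move: (marked_dyck_noflat _ _ _ ok).
by rewrite mem_cat inE !negb_or => /andP[].
Qed.

Lemma split_special_inj (u1 Q1 u2 Q2 : seq step) : Special \notin u1 ->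
  Special \notin u2 ->
  u1 ++ Special :: Q1 = u2 ++ Special :: Q2 -> u1 = u2 /\ Q1 = Q2.
Proof.
move=> S1 S2 E; have sz : size u1 = size u2.
  have := congr1 (index Special) E; rewrite !index_cat (negbTE S1) (negbTE S2) /=.
  by rewrite !addn0.
by move/eqP: E; rewrite eqseq_cat// eqseq_cons eqxx => /andP[/eqP -> /eqP ->].
Qed.

Lemma run_gt0 w : (0 < size (run w))%N.
Proof.
elim/last_ind: w => // w s; rewrite run_rcons.
by case: (run w) => // u [|t st] _; case: s => //=; case: u.
Qed.

(** The leftmost special step of the image, or its absence, locates the mark; [run] then recovers
    the stack and [run_inj] the prefix. *)
Lemma evolve_marked_inj par v1 v2 : marked_dyck true par 0 v1 ->
  marked_dyck true par 0 v2 ->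
  evolve_marked v1 = evolve_marked v2 -> v1 = v2.
Proof.
have E w : run (word (run w)) = run w by rewrite run_word ?run_gt0.
move=> /markedP[ok1|w1 Q1 -> ok1 _] /markedP[ok2|w2 Q2 -> ok2 _].
- rewrite !cats0 => /(congr1 run); rewrite !E.
  by apply: (run_inj par _ _ [::] [::]); rewrite cats0.
- by move/(congr1 (fun p => Special \in p));
  rewrite cats0 mem_cat mem_head orbT (negbTE (word_nospecial _)).
- by move/(congr1 (fun p => Special \in p));
  rewrite cats0 mem_cat mem_head orbT (negbTE (word_nospecial _)).
move/split_special_inj; rewrite !word_nospecial => -[]// /(congr1 run) + ->.
by rewrite !E => /(run_inj _ _ _ _ _ ok1 ok2) ->.
Qed.

(** Several cuts in [hybridP] give the same path; moving the cut right to the next special step, or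
    to the end, makes it canonical. *)
Lemma hybrid_marked par p :
  hybrid par p <-> exists2 v, marked_dyck true par 0 v & evolve_marked v = p.
Proof.
rewrite hybridP; split=> [[w [Q [ok ->]]]|[v /markedP[ok <-|w Q _ ok _ <-]]];
  last 2 first.
- by exists v, [::]; rewrite cats0.
- by exists w, (Special :: Q).
have [SQ|SQ] := boolP (Special \in Q); last first.
  have wQF := marked_dyck_noflat _ _ _ ok.
  exists (w ++ Q); first by rewrite marked_dyck_true_noflat.
  rewrite /evolve_marked (negbTE wQF) cats0 memNindex// take_size.
  by rewrite (word_run_cat par _ _ [::])// cats0.
have [QE Su] := index_split _ _ _ SQ; move: QE Su.
move: (take _ _) (drop _ _) => u Q' QE Su.
rewrite QE in ok *; have := marked_dyck_noflat _ _ _ ok.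
rewrite !mem_cat !negb_or => /and3P[wF uF _].
have wuF : Flat \notin w ++ u by rewrite mem_cat negb_or wF.
exists ((w ++ u) ++ Flat :: Q'); first by rewrite marked_dyck_unmark// -catA.
rewrite /evolve_marked mem_cat mem_head orbT index_cat (negbTE wuF) /= addn0.
rewrite take_size_cat// -[_ ++ Flat :: Q']cat_rcons drop_size_cat ?size_rcons//.
by rewrite (word_run_cat par _ _ (Special :: Q'))// -catA.
Qed.

Lemma size_evolve_marked par v : marked_dyck true par 0 v ->
  path_length (evolve_marked v) = size v.
Proof.
case/(markedP par) => [ok|w Q -> ok QF]; rewrite path_length_cat.
  by rewrite (path_length_run par v [::]) ?cats0// addn0.
rewrite (path_length_run _ _ _ ok) size_cat path_length_noflat//.
Qed.

Lemma card_hybrid par n :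
  #|` fset_set (hybrid par `&` [set p | path_length p = n])%classic |%fset =
    count_marked par true n 0.
Proof.
set A := (X in fset_set X).
pose L := [seq evolve_marked v | v <- words n & marked_dyck true par 0 v].
have Lu : uniq L.
  rewrite map_inj_in_uniq ?filter_uniq ?uniq_words// => v1 v2.
  by rewrite !mem_filter => /andP[ok1 _] /andP[ok2 _]; apply: (evolve_marked_inj par).
have -> : fset_set A = [fset x in L]%fset.
  apply/fsetP => p; rewrite in_fset_set ?inE; last exact: finite_path_length.
  apply/idP/mapP.
    rewrite inE => -[/hybrid_marked[v ok <-] /= vn].
    by exists v; rewrite // mem_filter ok mem_words -vn (size_evolve_marked par)/=.
  case=> v; rewrite mem_filter mem_words => /andP[ok /eqP vn] ->; rewrite inE; split.
    by apply/hybrid_marked; exists v.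
  by rewrite /= (size_evolve_marked par).
by rewrite card_fseq undup_id// size_map size_filter.
Qed.

(** * Closed forms, and the hybrid series in terms of block series *)

(* The relations make [x] and [R] rational functions of [y], so that the
   identities hold without any relation left. *)
Lemma closed_forms (F : fieldType) (x R y s e : F) :
  2 != 0 :> F -> x != 0 -> R != 0 -> y != 0 -> 1 + y != 0 ->
  x * (y + y ^+ 2) = y - 1 -> R = 1 - x - x * y *+ 2 -> s *+ 2 = y + 1 ->
  e * R = x * s ->
  let L := s * (1 + x * y * e) in
  let B := y * (1 + (x * s * e *+ 2 + x * s)) in
  [/\ L = (R + 1 - x) / 2 * (2 * (R + x) / (R * (R + x + 1)))
            * (2 / (R + x + 1)),
      B = ((R + 1 - x) / 2 - 1 + x - R * (R + x) / 2 + 3 / 2 - 3 * x / 2)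
            * (2 * (R + x) / (R * (R + x + 1))) * (2 / (R + x + 1)),
      L = (1 - 5 * x + R) / (((x - 1) ^+ 2 + (x + 1) * R) * R)
    & B = (7 * x - 2 * x ^+ 2 - 1 + R) / (2 * x * R) - 1].
Proof.
move=> n2 x0 R0 y0 y1 xy RE sy eR.
have xE : x = (y - 1) / (y * (1 + y)) by rewrite -xy; field; rewrite y0 y1.
have {}RE : R = (1 + 2 * y - y ^+ 2) / (y * (1 + y)).
  by rewrite RE xE; field; rewrite y0 y1.
have {}sy : s = (1 + y) / 2.
  by apply: (mulIf n2); rewrite divfK// mulr_natr sy addrC.
have q0 : 1 + 2 * y - y ^+ 2 != 0 by apply: contraNneq R0 => q0; rewrite RE q0 mul0r.
have ym1 : y - 1 != 0 by apply: contraNneq x0 => q0'; rewrite xE q0' mul0r.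
have eE : e = (y - 1) * (1 + y) / (2 * (1 + 2 * y - y ^+ 2)).
  apply: (mulIf R0); rewrite eR xE sy RE; field; rewrite ?y0 ?y1 ?n2 ?q0//.
(* After clearing powers of [y * (1 + y)], the denominators [R + x + 1] and
   [(x - 1) ^+ 2 + (x + 1) * R] become [4 y] and [8 y^2]. *)
have y4 : 1 + 2 * y - y ^+ 2 + (y - 1) + y * (1 + y) != 0.
  have -> : 1 + 2 * y - y ^+ 2 + (y - 1) + y * (1 + y) = 2 * 2 * y by ring.
  by rewrite !mulf_neq0.
have y8 : (y - 1 + -1 * (y * (1 + y))) ^+ 2
          + (y - 1 + y * (1 + y)) * (1 + 2 * y - y ^+ 2) != 0.
  rewrite [X in X != 0](_ : _ = 2 * 2 * 2 * y ^+ 2); last by ring.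
  by rewrite !mulf_neq0 ?expf_neq0.
by move=> L B; rewrite /L /B eE sy RE xE; split; field; rewrite y1 y0 q0 ?y4 ?y8 ?ym1.
Qed.

(* The weights of downsteps from odd and even heights are [1 + da] and [1 + db];
   [c], [d], [alpha], [beta] are the logarithmic derivatives of [u], [v] and of
   these weights. *)
Lemma hybrid_seriesE (par : bool) (u v c d alpha beta : {fps rat}) :
  let da : {fps rat} := par%:R in let db : {fps rat} := (~~ par)%:R in
  u = 1 + (1 + da) * fpsX * u * v -> v = 1 + (1 + db) * fpsX * u * v ->
  (1 + da) * alpha = da -> (1 + db) * beta = db ->
  c = (1 + da) * fpsX * v * (c + d) + da * fpsX * v ->
  d = (1 + db) * fpsX * u * (c + d) + db * fpsX * u ->
  hybrid_series (hybrid par) = u * (1 + c).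
Proof.
move=> da db uE vE aE bE cE dE.
(* [q] is the weight of a descent by two levels, with a block and a downstep of each parity, and [f]
   its logarithmic derivative. *)
pose q := (1 + da) * (1 + db) * u * v.
pose f := c + d + alpha + beta.
(* the series of the suffixes from height [h], without ([m = false]) or with a mark
   allowed *)
pose g (m : bool) h := if odd h
  then (1 + da) * u * v * q ^+ h./2 * (1 + m%:R * (c + d + alpha + h./2%:R * f))
  else u * q ^+ h./2 * (1 + m%:R * (c + h./2%:R * f)).
(* As vanishing differences, the equations combine with explicit cofactors into each recurrence,
   which [ring] checks. *)
have Eu : u - (1 + (1 + da) * fpsX * u * v) = 0 by rewrite -uE subrr.
have Ev : v - (1 + (1 + db) * fpsX * u * v) = 0 by rewrite -vE subrr.
have Ea : (1 + da) * alpha - da = 0 by rewrite aE subrr.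
have Eb : (1 + db) * beta - db = 0 by rewrite bE subrr.
have Ec : c - ((1 + da) * fpsX * v * (c + d) + da * fpsX * v) = 0 by rewrite -cE subrr.
have Ed : d - ((1 + db) * fpsX * u * (c + d) + db * fpsX * u) = 0 by rewrite -dE subrr.
have g0 m : g m 0%N = 1 + fpsX * g m 1%N.
  apply/subr0_eq; rewrite /g /= expr0.
  transitivity ((1 + m%:R * c) * (u - (1 + (1 + da) * fpsX * u * v))
    + m%:R * (u * (c - ((1 + da) * fpsX * v * (c + d) + da * fpsX * v))
              - c * (u - (1 + (1 + da) * fpsX * u * v))
              - fpsX * u * v * ((1 + da) * alpha - da))); first by ring.
  by rewrite Eu Ea Ec; ring.
have gS m h : g m h.+1 = fpsX * g m h.+2 + g m h +
     (if odd h.+1 then da else db) * (g m h + m%:R * g false h).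
  apply/subr0_eq; rewrite /g /= negbK uphalf_half; case: (odd h) => /=;
    rewrite ?add0n ?add1n ?exprS.
    set Q := q ^+ _; set k := h./2; rewrite -[k.+1%:R]/((1 + k)%:R) natrD.
    transitivity ((1 + da) * (1 + db) * u * v * Q *
      ((1 + m%:R * (c + k%:R * f + f)) * (u - (1 + (1 + da) * fpsX * u * v))
       + m%:R * (u * (c - ((1 + da) * fpsX * v * (c + d) + da * fpsX * v))
                 - c * (u - (1 + (1 + da) * fpsX * u * v))
                 - fpsX * u * v * ((1 + da) * alpha - da)))
      + m%:R * (1 + da) * u * v * Q * ((1 + db) * beta - db)).
      by rewrite /q /f; ring.
    by rewrite Eu Ea Eb Ec; ring.
  set Q := q ^+ _; set k := h./2; rewrite -[k.+1%:R]/((1 + k)%:R) natrD.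
  transitivity ((1 + da) * u * Q *
      ((1 + m%:R * (c + k%:R * f + alpha)) * (v - (1 + (1 + db) * fpsX * u * v))
       + m%:R * (v * (d - ((1 + db) * fpsX * u * (c + d) + db * fpsX * u))
                 - fpsX * u * v * ((1 + db) * beta - db)))
      + m%:R * u * Q * ((1 + da) * alpha - da)).
    by rewrite /q /f; ring.
  by rewrite Ev Ea Eb Ed; ring.
apply/fpsP => n; transitivity (coefs (g true 0%N) n); last first.
  by congr coefs; rewrite /g /= expr0; ring.
rewrite (@coef_count_marked par g g0); first by rewrite addn0 /= card_hybrid.
move=> m h; rewrite gS; congr (_ + _).
have -> : m%:R * g false h = if m then g false h else 0 by case: m;
  rewrite ?mul0r ?mul1r.
move: (_ + _) => G; rewrite /da /db oddS.
by clear; case: par (odd h) => -[]; rewrite ?mul0r ?mul1r.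
Qed.

(** * Schröder series and the final substitution *)

(* As [r ^+ 2 = x^2 - 6 x + 1], its series times [r] is the inverse of [r]. *)
Fixpoint inv_quad_coef n : rat :=
  if n is n1.+1 then (if n1 is n2.+1 then inv_quad_coef n1 *+ 6 - inv_quad_coef n2
    else 6) else 1.

Lemma quad_inv_quad : (fpsX ^+ 2 - 6 * fpsX + 1) * Fps inv_quad_coef = 1 :> {fps rat}.
Proof.
set W := Fps inv_quad_coef.
have WE : W = 1 + fpsX * (W *+ 6 - fpsX * W).
  apply/fpsP => -[|n].
    transitivity (1 + coefs (fpsX * (W *+ 6 - fpsX * W)) 0) => //.
    by rewrite coef_fpsXM0 addr0.
  transitivity (0 + coefs (fpsX * (W *+ 6 - fpsX * W)) n.+1) => //.
  rewrite coef_fpsXMS add0r.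
  transitivity (inv_quad_coef n *+ 6 - coefs (fpsX * W) n) => //.
  by case: n => [|n]; rewrite ?coef_fpsXM0 ?subr0// coef_fpsXMS.
have -> : (fpsX ^+ 2 - 6 * fpsX + 1) * W = W - fpsX * (W *+ 6 - fpsX * W) by ring.
by rewrite {1}WE addrK.
Qed.

Lemma fps_double_eqP (p q : {fps rat}) : (forall n, coefs p n = coefs q n / 2) ->
  p *+ 2 = q.
Proof.
move=> pq; apply/fpsP => n; transitivity (coefs p n *+ 2) => //.
by rewrite pq; field.
Qed.

Lemma tofrac_neq0 (p : {fps rat}) : coefs p 0 != 0 -> p%:F != 0.
Proof.
by rewrite tofrac_eq0; apply: contraNneq => ->.
Qed.

Theorem theorem8 (r : {fps rat})
    (r_sqrt : r ^+ 2 = fpsX ^+ 2 - 6 * fpsX + 1) (r_cst : coefs r 0 = 1) :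
  let x : {fraction {fps rat}} := fpsX%:F in
  let R : {fraction {fps rat}} := r%:F in
  let L : {fraction {fps rat}} := (hybrid_series little_hybrid)%:F in
  let B : {fraction {fps rat}} := (hybrid_series big_hybrid)%:F in
  [/\ L = (R + 1 - x) / 2 * (2 * (R + x) / (R * (R + x + 1)))
            * (2 / (R + x + 1)),
      B = ((R + 1 - x) / 2 - 1 + x - R * (R + x) / 2 + 3 / 2 - 3 * x / 2)
            * (2 * (R + x) / (R * (R + x + 1))) * (2 / (R + x + 1)),
      L = (1 - 5 * x + R) / (((x - 1) ^+ 2 + (x + 1) * R) * R)
    & B = (7 * x - 2 * x ^+ 2 - 1 + R) / (2 * x * R) - 1].
Proof.
(* [S] is [(1 - x - r) / (2 x)], the large Schröder series; the index shift divides by [x], as the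
   constant terms cancel. *)
pose S : {fps rat} := Fps (fun n => coefs (1 - fpsX - r) n.+1 / 2).
have SE : r = 1 - fpsX - (fpsX * S) *+ 2.
  have -> : (fpsX * S) *+ 2 = 1 - fpsX - r.
    apply: fps_double_eqP => -[|n]; last by rewrite coef_fpsXMS.
    rewrite coef_fpsXM0; transitivity ((1 - 0 - coefs r 0) / 2) => //.
      by rewrite r_cst subr0 subrr mul0r.
  by ring.
(* [s] is the little Schröder series. *)
pose s : {fps rat} := Fps (fun n => coefs (S + 1) n / 2).
have sE : s *+ 2 = S + 1 by apply: fps_double_eqP.
have x0 : (fpsX : {fps rat}) != 0 by apply/eqP => /fpsP/(_ 1%N)/eqP.
have xS : fpsX * (S + S ^+ 2) = S - 1.
  (* Multiplied by [4 x], the relation is the equation for [r ^+ 2] with [r] replaced through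
     [SE]. *)
  have x40 : fpsX *+ 4 != 0 :> {fps rat}.
    by apply/eqP => /fpsP/(_ 1%N)/eqP.
  apply/(mulfI x40)/subr0_eq.
  transitivity ((1 - fpsX - (fpsX * S) *+ 2) ^+ 2 - (fpsX ^+ 2 - 6 * fpsX + 1));
    first by ring.
  by rewrite -SE r_sqrt subrr.
have S0 : coefs S 0 = 1.
  by have := congr1 (fun p => coefs p 0) xS; rewrite coef_fpsXM0 => /esym/subr0_eq.
pose W := Fps inv_quad_coef.
(* [e] is [x s / r], as [W] inverts [r ^+ 2]. By [eE] it equals [c + d], the logarithmic derivative
   of [s * S], in both cases below. *)
pose e := fpsX * s * r * W.
have er : e * r = fpsX * s.
  transitivity (fpsX * s * ((r ^+ 2) * W)); first by rewrite /e; ring.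
  by rewrite r_sqrt quad_inv_quad mulr1.
have eE : e = fpsX * S * e + fpsX * s * e *+ 2 + fpsX * s.
  apply/subr0_eq.
  transitivity (e * (1 - fpsX * S - fpsX * (s *+ 2)) - fpsX * s); first by ring.
  rewrite -er sE SE; ring.
have sF : s = 1 + fpsX * s * S.
  have n2 : 2%:R != 0 :> {fps rat} by apply/eqP => /fpsP/(_ 0%N)/eqP.
  apply/(mulfI n2)/subr0_eq.
  transitivity (s *+ 2 - 2%:R - fpsX * (s *+ 2) * S); first by ring.
  rewrite sE; transitivity (S - 1 - fpsX * (S + S ^+ 2)); first by ring.
  by rewrite xS subrr.
have SF : S = 1 + fpsX * (s *+ 2) * S.
  by rewrite sE; apply/subr0_eq; transitivity (S - 1 - fpsX * (S + S ^+ 2));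
    [ring|rewrite xS subrr].
(* The logarithmic derivative of a downstep weight 2; that of a weight 1 is 0. *)
pose half : {fps rat} := Fps (fun n => coefs (1 : {fps rat}) n / 2).
have halfE : (1 + 1) * half = 1 by rewrite -[1 + 1]/(2%:R) mulr_natl;
  apply: fps_double_eqP.
(* Special steps from even heights close arches based at odd height, so odd blocks give [S] and even
   ones [s]; the big case swaps them. *)
have LE : hybrid_series little_hybrid = s * (1 + fpsX * S * e).
  apply: (@hybrid_seriesE false s S (fpsX * S * e) (fpsX * s * e *+ 2 + fpsX * s) 0
    half) => /=.
  - by rewrite {1}sF; ring.
  - by rewrite {1}SF; ring.
  - by ring.
  - exact: halfE.
  - by rewrite addrA -eE; ring.
  - by rewrite addrA -eE; ring.
have BE : hybrid_series big_hybrid = S * (1 + (fpsX * s * e *+ 2 + fpsX * s)).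
  apply: (@hybrid_seriesE true S s (fpsX * s * e *+ 2 + fpsX * s) (fpsX * S * e) half
    0) => /=.
  - by rewrite {1}SF; ring.
  - by rewrite {1}sF; ring.
  - exact: halfE.
  - by ring.
  - by rewrite [_ + fpsX * S * e]addrC addrA -eE; ring.
  - by rewrite [_ + fpsX * S * e]addrC addrA -eE; ring.
have y0 : S%:F != 0 by apply: tofrac_neq0; rewrite S0.
have y1 : (1 + S)%:F != 0.
  by apply: tofrac_neq0; rewrite [coefs _ 0](_ : _ = 1 + coefs S 0)// S0.
have R0 : r%:F != 0 by apply: tofrac_neq0; rewrite r_cst.
have n2 : 2 != 0 :> {fraction {fps rat}}.
  by rewrite -tofrac1 -tofracMn; apply: tofrac_neq0.
have x0' : (fpsX : {fps rat})%:F != 0 by rewrite tofrac_eq0.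
rewrite LE BE; clear LE BE.
clearbody S s e.
have xSF : fpsX%:F * (S%:F + S%:F ^+ 2) = S%:F - 1
  by rewrite expr2 -tofracM -tofracD -tofracM -expr2 xS tofracB tofrac1.
have rF : r%:F = 1 - fpsX%:F - fpsX%:F * S%:F *+ 2.
  by rewrite SE !tofracB tofracMn tofracM tofrac1.
have sF2 : s%:F *+ 2 = S%:F + 1 by rewrite -tofracMn sE tofracD tofrac1.
have eF : e%:F * r%:F = fpsX%:F * s%:F by rewrite -!tofracM er.
rewrite tofracD tofrac1 in y1.
move=> x R L B; rewrite /L /B !(tofracM, tofracD, tofracMn, tofrac1).
exact: (closed_forms _ _ _ _ _ _ n2 x0' R0 y0 y1 xSF rF sF2 eF).
Qed.
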